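(* Let $0<\mu\le 1$, $R>0$, $v_P>0$, $t_{\max}=R/v_P$, $0<\Delta t<t_{\max}$ and $s=v_P\Delta t$. A pursuer with maximum range $R$ and speed $v_P$ launched from the point $O\in\mathbb{R}^2$ a time $\Delta t$ in the past, and its current position is unknown (it may be any point of the closed disk of radius $s$ centered at $O$). Let the evader be at $E\in\mathbb{R}^2$ with $r=\|E-O\|>0$, and suppose $$\frac{\mu^2(R-s)^2+r^2-R^2}{2\mu r(R-s)}\in[-1,1].$$ Then the maximum cutting angle $\varphi\in[-\pi/2,\pi/2]$ (measured with respect to the normal of the line from $O$ to $E$) that is safe from the pursuer, i.e. safe whatever the pursuer's current position in that disk, is $$\varphi_{\max}^{\mathrm{L2}}=\arcsin\left(\frac{\mu^2(R-s)^2+r^2-R^2}{2\mu r(R-s)}\right).$$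
   Context: An evader and a pursuer move in the plane with constant speeds $v_E>0$ and $v_P>0$ and can change heading instantaneously; $\mu=v_E/v_P$, and throughout $\mu\le 1$. The pursuer can move for at most time $t_{\max}$ after launch, so its total range is $R=v_Pt_{\max}$; its reachability region is the disk of radius $R$ around its initial location $O$. After it has been in flight for time $\Delta t$ its remaining range is $R-s$, where $s=v_P\Delta t$. The evader knows $O$, $v_P$, $R$ and $\Delta t$, but not the pursuer's current position (''knowledge level 2''). Engagement zone (EZ): for a pursuer at position $P$ with remaining range $\rho$, and an evader with unit heading vector $u$, the EZ is the disk of radius $\rho$ centered at $P-\mu\rho\,u$. The evader at $E$ is ''inside the EZ'' if $\|E-(P-\mu\rho\,u)\|<\rho$; the boundary does not count as inside (interceptions at exactly maximum range are neglected). A heading $u$ is safe from a pursuer at $P$ with remaining range $\rho$ if the evader is not inside the corresponding EZ. Here $\rho=R-s$, and a heading is safe under knowledge level 2 if it is safe from a pursuer with remaining range $R-s$ at every point $P$ with $\|P-O\|\le s$. Cutting angle: let $n=(E-O)/\|E-O\|$ and let $\tau$ be the unit vector obtained by rotating $n$ clockwise by $\pi/2$ (the turn direction is fixed as clockwise). The heading with cutting angle $\varphi\in[-\pi/2,\pi/2]$ is $u(\varphi)=\cos\varphi\,\tau-\sin\varphi\,n$. ''Maximum safe cutting angle'' means the largest $\varphi\in[-\pi/2,\pi/2]$ for which $u(\varphi)$ is safe. *)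

(* Defs.v *)
(* Stdlib reals with Coquelicot.  The plane is Coquelicot's C = R * R, whose
   modulus Cmod is the Euclidean norm; real scalars enter through RtoC. *)
From Stdlib Require Import Reals.
From Coquelicot Require Import Coquelicot.
Open Scope R_scope.

Definition ez_center (mu rho : R) (P u : C) : C :=
  (P - RtoC (mu * rho) * u)%C.

(* The strict inequality neglects interceptions at exactly maximum range. *)
Definition inside_ez (mu rho : R) (P E u : C) : Prop :=
  Cmod (E - ez_center mu rho P u)%C < rho.

Definition safe_heading (mu rho : R) (P E u : C) : Prop :=
  ~ inside_ez mu rho P E u.

(* [Rg] is the pursuer's total range and [s] the distance it has already
   travelled since its launch from [O]. *)
Definition safe_heading_L2 (mu Rg s : R) (O E u : C) : Prop :=
  forall P : C, Cmod (P - O)%C <= s -> safe_heading mu (Rg - s) P E u.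

Definition radial_dir (O E : C) : C :=
  ((E - O) / RtoC (Cmod (E - O)))%C.

(* Multiplication by -i is the clockwise rotation by PI/2. *)
Definition tangential_dir (O E : C) : C :=
  (- Ci * radial_dir O E)%C.

Definition cutting_heading (O E : C) (phi : R) : C :=
  (RtoC (cos phi) * tangential_dir O E - RtoC (sin phi) * radial_dir O E)%C.

Definition safe_cutting_angle_L2 (mu Rg s : R) (O E : C) (phi : R) : Prop :=
  - (PI / 2) <= phi <= PI / 2 /\
  safe_heading_L2 mu Rg s O E (cutting_heading O E phi).

Definition is_max_safe_cutting_angle_L2
    (mu Rg s : R) (O E : C) (phi : R) : Prop :=
  safe_cutting_angle_L2 mu Rg s O E phi /\
  forall psi : R, safe_cutting_angle_L2 mu Rg s O E psi -> psi <= phi.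

(* Main.v *)
Require Import Defs.
From Stdlib Require Import Reals Lra.
From Coquelicot Require Import Coquelicot.
Open Scope R_scope.

(** A heading [u] is safe for every position [P] with [|P - O| <= s] exactly when
    [W = E - O + mu (Rg - s) u] is at distance at least [Rg - s] from every point
    of the disk of radius [s] about [0], that is, when [|W| >= Rg].  By the law of
    cosines [|W|^2 = r^2 + mu^2 (Rg - s)^2 - 2 mu (Rg - s) r sin phi] for the
    heading of cutting angle [phi], so safety is an upper bound on [sin phi], and
    [sin] is increasing on [[-PI/2, PI/2]]. *)

Lemma Cmod_sqr (z : C) : Cmod z ^ 2 = fst z ^ 2 + snd z ^ 2.
Proof. unfold Cmod. apply pow2_sqrt. nra. Qed.

Lemma safe_heading_L2_iff (mu Rg s : R) (O E u : C) :
  0 <= s < Rg ->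
  safe_heading_L2 mu Rg s O E u <->
  Rg <= Cmod (E - O + RtoC (mu * (Rg - s)) * u)%C.
Proof.
  intros Hs.
  set (W := (E - O + RtoC (mu * (Rg - s)) * u)%C).
  assert (Hsub : forall P, (E - ez_center mu (Rg - s) P u = W - (P - O))%C)
    by (intros P; unfold W, ez_center; ring).
  unfold safe_heading_L2, safe_heading, inside_ez.
  split.
  - intros Hsafe.
    destruct (Rle_lt_dec Rg (Cmod W)) as [HW | HW]; [exact HW | exfalso].
    (* The scaled point [(s / Rg) W] lies in the disk of radius [s], at distance
       [(1 - s / Rg) |W| < Rg - s] from [W]. *)
    assert (Hq : 0 <= s / Rg < 1).
    { split; [apply Rdiv_le_0_compat; lra | apply Rlt_div_l; lra]. }
    assert (Hqs : s / Rg * Rg = s) by (field; lra).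
    assert (HP : (O + RtoC (s / Rg) * W - O = RtoC (s / Rg) * W)%C) by ring.
    apply (Hsafe (O + RtoC (s / Rg) * W)%C).
    + rewrite HP, Cmod_mult, Cmod_R, Rabs_pos_eq by lra. nra.
    + rewrite Hsub, HP.
      replace (W - RtoC (s / Rg) * W)%C with (RtoC (1 - s / Rg) * W)%C
        by (rewrite RtoC_minus; ring).
      rewrite Cmod_mult, Cmod_R, Rabs_pos_eq by lra. nra.
  - intros HW P HP Hin.
    rewrite Hsub in Hin.
    (* If [P] threatened the evader, then [Cmod W] would be less than [(Rg - s) + s = Rg]. *)
    pose proof (Cmod_triangle (W - (P - O)) (P - O)) as Htri.
    replace (W - (P - O) + (P - O))%C with W in Htri by ring.
    lra.
Qed.

(** The heading is a unit vector whose component along [E - O] is [- sin phi], which gives the cross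
    term its sign. *)
Lemma Cmod_cutting_heading_sqr (k phi : R) (O E : C) :
  0 < Cmod (E - O)%C ->
  Cmod (E - O + RtoC k * cutting_heading O E phi)%C ^ 2 =
  Cmod (E - O)%C ^ 2 + k ^ 2 - 2 * k * Cmod (E - O)%C * sin phi.
Proof.
  intros Hr.
  unfold cutting_heading, tangential_dir, radial_dir, Cdiv.
  rewrite <- RtoC_inv by lra.
  pose proof (Cmod_sqr (E - O)%C) as Hr2.
  pose proof (sin2_cos2 phi) as Hsc. unfold Rsqr in Hsc.
  revert Hr Hr2. generalize (E - O)%C. intros [a b].
  generalize (Cmod (a, b)). intros r Hr Hr2. simpl in Hr2.
  rewrite Cmod_sqr. simpl.
  (* This form is a rational identity in which [r] is independent of [a] and [b], so [field]
     suffices. The relations [r ^ 2 = a ^ 2 + b ^ 2] and [Hsc] enter only afterwards. *)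
  transitivity (a ^ 2 + b ^ 2
    + k ^ 2 * ((a ^ 2 + b ^ 2) / r ^ 2) * (sin phi * sin phi + cos phi * cos phi)
    - 2 * k * ((a ^ 2 + b ^ 2) / r) * sin phi); [field; lra |].
  replace (a ^ 2 + b ^ 2) with (r ^ 2) by lra.
  rewrite Hsc. field. lra.
Qed.

Lemma safe_cutting_heading_iff (mu Rg s phi : R) (O E : C) :
  0 < mu -> 0 <= s < Rg -> 0 < Cmod (E - O)%C ->
  safe_heading_L2 mu Rg s O E (cutting_heading O E phi) <->
  sin phi <= (mu ^ 2 * (Rg - s) ^ 2 + Cmod (E - O)%C ^ 2 - Rg ^ 2)
             / (2 * mu * Cmod (E - O)%C * (Rg - s)).
Proof.
  intros Hmu Hs Hr.
  rewrite safe_heading_L2_iff by exact Hs.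
  pose proof (Cmod_cutting_heading_sqr (mu * (Rg - s)) phi O E Hr) as HW.
  revert HW.
  pose proof (Cmod_ge_0
    (E - O + RtoC (mu * (Rg - s)) * cutting_heading O E phi)%C) as HW0.
  revert HW0.
  generalize (Cmod (E - O + RtoC (mu * (Rg - s)) * cutting_heading O E phi)%C).
  intros w HW0 HW.
  assert (Hd : 0 < 2 * mu * Cmod (E - O)%C * (Rg - s))
    by (repeat apply Rmult_lt_0_compat; lra).
  (* With the positive denominator cleared, [HW] turns the bound on [sin phi] into
     [Rg ^ 2 <= w ^ 2]. *)
  rewrite <- (Rle_div_r _ _ _ Hd).
  split; intros H.
  - assert (Rg ^ 2 <= w ^ 2) by (apply pow_incr; lra). lra.
  - apply Rsqr_incr_0_var; [unfold Rsqr; lra | exact HW0].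
Qed.

Theorem mainTheorem2
  (mu Rg vP tmax dt s r : R) (O E : C)
  (hmu : 0 < mu <= 1) (hRg : 0 < Rg) (hvP : 0 < vP)
  (htmax : tmax = Rg / vP) (hdt : 0 < dt < tmax) (hs : s = vP * dt)
  (hr : r = Cmod (E - O)%C) (hr0 : 0 < r)
  (harg : -1 <= (mu ^ 2 * (Rg - s) ^ 2 + r ^ 2 - Rg ^ 2)
                / (2 * mu * r * (Rg - s)) <= 1) :
  is_max_safe_cutting_angle_L2 mu Rg s O E
    (asin ((mu ^ 2 * (Rg - s) ^ 2 + r ^ 2 - Rg ^ 2)
           / (2 * mu * r * (Rg - s)))).
Proof.
  assert (Hs : 0 <= s < Rg).
  { assert (vP * tmax = Rg) by (rewrite htmax; field; lra). nra. }
  subst r.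
  split; [split |].
  - apply asin_bound.
  - apply safe_cutting_heading_iff; [lra | exact Hs | exact hr0 |].
    (* The bound on the sine is attained with equality. *)
    rewrite sin_asin by exact harg. apply Rle_refl.
  - intros psi [Hpsi Hsafe].
    apply safe_cutting_heading_iff in Hsafe; [| lra | exact Hs | exact hr0].
    pose proof (asin_bound ((mu ^ 2 * (Rg - s) ^ 2 + Cmod (E - O)%C ^ 2 - Rg ^ 2)
      / (2 * mu * Cmod (E - O)%C * (Rg - s)))).
    apply sin_incr_0; try lra.
    rewrite sin_asin by exact harg. exact Hsafe.
Qed.
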